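(* Let $s(z)=\tfrac12(z^2+2z)e^{-z}$ and $t(z)=-\tfrac18(z^4+4z^3+8z^2+16z)e^{-z}$ for $z\in\mathbb{R}$. (i) If $\rho_n\in[-1,0]$ for all $n\ge1$, then for any $x,y\in\mathbb{R}$ $$\lim_{n\to\infty} b_n^2\Big[b_n^2\big(F_{\rho_n}^n(u_n(x),u_n(y))-H_\infty(x,y)\big)-(s(x)+s(y))H_\infty(x,y)\Big]=\left(t(x)+t(y)+\frac12(s(x)+s(y))^2\right)H_\infty(x,y).$$ (ii) If $\rho_n=1$ for all $n\ge1$, then for any $x,y\in\mathbb{R}$ $$\lim_{n\to\infty} b_n^2\Big[b_n^2\big(F_{1}^n(u_n(x),u_n(y))-H_0(x,y)\big)-s(\min(x,y))H_0(x,y)\Big]=\left(t(\min(x,y))+\frac12\big(s(\min(x,y))\big)^2\right)H_0(x,y).$$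
   Context: $\Phi$ is the standard normal $N(0,1)$ distribution function. The constant $b_n$ is defined by $n(1-\Phi(b_n))=1$, and $u_n(z)=b_n+z/b_n$ for $z\in\mathbb{R}$ (for $n\ge 3$, so that $b_n>0$). For $\rho\in[-1,1]$, $F_\rho$ is the joint distribution function of a (possibly degenerate) bivariate Gaussian vector with zero means, unit variances and correlation $\rho$; $F_\rho^n$ is its $n$-th power. $H_0(x,y)=\exp(-e^{-\min(x,y)})$ and $H_\infty(x,y)=\Lambda(x)\Lambda(y)$, where $\Lambda(x)=\exp(-e^{-x})$. *)

(* Defs.v *)
From mathcomp Require Import all_boot all_order all_algebra.
From mathcomp Require Import all_classical all_reals all_analysis.

Set Implicit Arguments.
Unset Strict Implicit.
Unset Printing Implicit Defensive.
Import Order.TTheory GRing.Theory Num.Theory.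
Import numFieldNormedType.Exports.

Local Open Scope classical_set_scope.
Local Open Scope ring_scope.

Section gaussian_vectors.
Context {R : realType} {d : measure_display} {T : measurableType d}.
Variable P : probability T R.

(* [normal_prob m 0] is not a point mass in the library, hence the separate
   degenerate case.  The laws are compared on measurable sets only, since
   both sides are total functions on [set R]. *)
Definition gaussian (Z : T -> R) : Prop :=
  (exists m : R, forall A : set R, measurable A ->
     pushforward P Z A = \d_m A) \/
  (exists m s : R, 0 < s /\ forall A : set R, measurable A ->
     pushforward P Z A = normal_prob m s A).

Definition gaussian_vector (X Y : {RV P >-> R}) : Prop :=
  forall a b : R, gaussian (fun w => a * X w + b * Y w).

Definition correlation (X Y : {RV P >-> R}) : R :=
  fine (covariance P X Y) /
  (Num.sqrt (fine 'V_P[X]) * Num.sqrt (fine 'V_P[Y])).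

Definition joint_cdf (X Y : {RV P >-> R}) (x y : R) : R :=
  fine (P [set w | X w <= x /\ Y w <= y]).

End gaussian_vectors.

(* [G] is the function F_rho: the joint distribution function of some (possibly
   degenerate) Gaussian vector with zero means, unit variances and correlation
   [rho]. *)
Definition gaussian_cdf {R : realType} (rho : R) (G : R -> R -> R) : Prop :=
  exists (d : measure_display) (T : measurableType d) (P : probability T R)
    (X Y : {RV P >-> R}),
    [/\ gaussian_vector X Y,
        ('E_P[X] = 0 /\ 'E_P[Y] = 0)%E,
        ('V_P[X] = 1 /\ 'V_P[Y] = 1)%E,
        correlation X Y = rho &
        forall x y : R, G x y = joint_cdf X Y x y].

Section extremes.
Context {R : realType}.
Implicit Types (b x y z : R).

Definition Phi z : R := fine (normal_prob (0 : R) 1 `]-oo, z]).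

(* [unorm (b n) z] is u_n(z). *)
Definition unorm b z : R := b + z / b.

Definition Lambda x : R := expR (- expR (- x)).

Definition H0 x y : R := expR (- expR (- Num.min x y)).

Definition Hinfty x y : R := Lambda x * Lambda y.

Definition s_fun z : R := 2^-1 * (z ^+ 2 + 2 * z) * expR (- z).

Definition t_fun z : R :=
  - 8^-1 * (z ^+ 4 + 4 * z ^+ 3 + 8 * z ^+ 2 + 16 * z) * expR (- z).

End extremes.

(* Main.v *)
Require Import Defs.
From HB Require Import structures.
From mathcomp Require Import all_boot all_order all_algebra.
From mathcomp Require Import all_classical all_reals all_analysis.
From mathcomp Require Import measurable_realfun ring lra.

Set Implicit Arguments.
Unset Strict Implicit.
Unset Printing Implicit Defensive.
Import Order.TTheory GRing.Theory Num.Theory.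
Import numFieldNormedType.Exports.

Local Open Scope classical_set_scope.
Local Open Scope ring_scope.

(** Write p(u) = 1 - Phi(u), h = 1/b_n^2 and u = u_n(x) = b_n (1 + x h), so that
n p(u) = p(u) / p(b_n).  With G(u) = phi(u) (1/u - 1/u^3 + 3/u^5) one has
-G'(u) = phi(u) (1 + 15/u^6), whence p(u) <= G(u) <= (1 + 15/u^6) p(u), and
expanding G(u) / G(b_n) in powers of h gives
n p(u_n(x)) = e^-x - s(x) h - t(x) h^2 + o(h^2).  Since 1/n = o(h^2), the n-th
power of 1 - p_n is exp(- n p_n) up to o(h^2), and exponentiating the expansion
gives the limits, with p_n = p(u_n(min(x, y))) when rho = 1, because then X = Y
almost surely.  When rho <= 0, p_n is p(u) + p(v) - P(X > u, Y > v), and the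
last term is negligible because it is at most P(X + Y > u + v), where X + Y is
a centered Gaussian of variance 2 (1 + rho) <= 2: this is of order e^(-b_n^2),
whereas 1/n is of order e^(-b_n^2/2) / b_n. *)

(** * Second-order expansions *)

Section expansions.
Context {R : realType}.
Implicit Types (h f k : nat -> R) (a b c : R).

(* The remainder is absorbed in [g], so that no division by [h n] occurs. *)
Definition expands2 h f a b c : Prop :=
  exists2 g : nat -> R, g n @[n --> \oo] --> c &
    \forall n \near \oo, f n = a + h n * b + h n ^+ 2 * g n.

(** The calculus rules below produce unsimplified coefficients; this replaces them by closed forms
    once an expansion has been assembled. *)
Lemma eq_expands2 h f k a b c a' b' c' :
  (\forall n \near \oo, f n = k n) -> a = a' -> b = b' -> c = c' ->
  expands2 h f a b c -> expands2 h k a' b' c'.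
Proof.
move=> fk <- <- <- [g gc fE]; exists g => //.
by near=> n; rewrite -(near fk n)// (near fE n).
Unshelve. all: by end_near. Qed.

Lemma expands2_cst h a : expands2 h (fun=> a) a 0 0.
Proof.
exists (fun=> 0); first exact: cvg_cst.
by near=> n; rewrite !mulr0 !addr0.
Unshelve. all: by end_near. Qed.

Lemma expands2_id h : expands2 h h 0 1 0.
Proof.
exists (fun=> 0); first exact: cvg_cst.
by near=> n; rewrite mulr0 mulr1 addr0 add0r.
Unshelve. all: by end_near. Qed.

Lemma expands2D h f k a b c a' b' c' :
  expands2 h f a b c -> expands2 h k a' b' c' ->
  expands2 h (fun n => f n + k n) (a + a') (b + b') (c + c').
Proof.
move=> [g gc fE] [g' gc' kE]; exists (fun n => g n + g' n); first exact: cvgD.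
near=> n; rewrite (near fE n)// (near kE n)//; ring.
Unshelve. all: by end_near. Qed.

Lemma cvg_expands2 h f a b c : h n @[n --> \oo] --> 0 ->
  expands2 h f a b c -> f n @[n --> \oo] --> a.
Proof.
move=> h0 [g gc fE].
have : (a + h n * b + h n ^+ 2 * g n) @[n --> \oo] --> a + 0 * b + (0 * 0) * c.
  apply: cvgD.
    by apply: cvgD; [exact: cvg_cst | apply: cvgM => //; exact: cvg_cst].
  by apply: cvgM => //; apply: cvgM.
rewrite !mul0r !addr0; apply: cvg_trans; apply: near_eq_cvg.
by near=> n; rewrite (near fE n).
Unshelve. all: by end_near. Qed.

Lemma expands2M h f k a b c a' b' c' : h n @[n --> \oo] --> 0 ->
  expands2 h f a b c -> expands2 h k a' b' c' ->
  expands2 h (fun n => f n * k n) (a * a') (a * b' + b * a')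
    (a * c' + b * b' + c * a').
Proof.
move=> h0 ef ek; case: (ef) (ek) => [g gc fE] [g' gc' kE].
(* In f k = a k + h b k + h^2 g k only the first two terms are expanded further; in the third, [k]
   itself tends to a'. *)
exists (fun n => a * g' n + b * b' + g n * k n + h n * (b * g' n)).
  have -> : a * c' + b * b' + c * a' =
    a * c' + b * b' + c * a' + 0 * (b * c') by ring.
  have ck := cvg_expands2 h0 ek.
  apply: cvgD; last by apply: cvgM => //; apply: cvgMl_tmp.
  apply: cvgD; last exact: cvgM.
  by apply: cvgD; [exact: cvgMl_tmp | exact: cvg_cst].
near=> n; rewrite (near fE n)// (near kE n)//; ring.
Unshelve. all: by end_near. Qed.

Lemma expands2V h f a b c : h n @[n --> \oo] --> 0 -> a != 0 ->
  expands2 h f a b c ->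
  expands2 h (fun n => (f n)^-1) a^-1 (- b / a ^+ 2)
    ((b ^+ 2 - a * c) / a ^+ 3).
Proof.
move=> h0 a0 ef; case: (ef) => [g gc fE].
(* The exact remainder: multiply 1/f - 1/a + h b/a^2 by a^2 f and cancel h^2. *)
exists (fun n => (b ^+ 2 - a * g n + h n * (b * g n)) / (a ^+ 2 * f n)).
  have -> : (b ^+ 2 - a * c) / a ^+ 3 =
    (b ^+ 2 - a * c + 0 * (b * c)) / (a ^+ 2 * a) by congr (_ / _); ring.
  apply: cvgM; last first.
    apply: cvgV; first by rewrite mulf_neq0// expf_neq0.
    by apply: cvgMl_tmp; apply: cvg_expands2 ef.
  apply: cvgD; last by apply: cvgM => //; apply: cvgMl_tmp.
  by apply: cvgB; [exact: cvg_cst | exact: cvgMl_tmp].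
have fn0 : \forall n \near \oo, f n != 0.
  have ca := cvg_expands2 h0 ef.
  exact: (ca _ (open_nbhs_nbhs (conj (@open_neq _ 0) a0))).
near=> n; have := near fn0 n; rewrite (near fE n)// => Hn.
by field; rewrite a0 Hn//; near: n.
Unshelve. all: by end_near. Qed.

End expansions.

(** * Exponentials and n-th powers of expansions *)

Section exponential.
Context {R : realType}.
Implicit Types (h f p : nat -> R) (a b c t : R).

(** From e^-t >= 1 - t one gets (1 - t) e^t <= 1, hence (1 - t) (e^t - 1 - t) <= t^2, and here 1 - t
    >= 1/2. *)
Lemma expR_taylor1 t : t <= 2^-1 -> 0 <= expR t - 1 - t <= 2 * t ^+ 2.
Proof.
move=> t1; apply/andP; split; first by have := expR_ge1Dx t; lra.
have lb := expR_ge1Dx (- t); rewrite expRN in lb.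
have e0 := expR_gt0 t.
have eB : (1 - t) * expR t <= 1.
  by rewrite -ler_pdivlMr ?div1r//; lra.
have e2 : expR t <= 2 by nra.
have [dt0|dt0] := leP 0 (expR t - 1 - t); last by nra.
have : (1 - t) * (expR t - 1 - t) <= t ^+ 2 by nra.
nra.
Qed.

(** One application of l'Hospital's rule leaves (e^t - 1 - t) / (2 t), which [expR_taylor1] bounds
    by |t|. *)
Lemma cvg_expR_taylor2 :
  (expR t - 1 - t - t ^+ 2 / 2) / t ^+ 2 @[t --> (0 : R)^'] --> (0 : R).
Proof.
apply: (@lhopital R _ (fun t => expR t - 1 - t) _ (fun t => 2 * t) (-1) 1).
- by rewrite in_itv/=; apply/andP; split; lra.
- move=> x _; apply: is_derive_eq.
  by rewrite /GRing.scale/=; field.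
- by move=> x _; apply: is_derive_eq; rewrite /GRing.scale/=; ring.
- rewrite [X in _ --> X](_ : _ = expR 0 - 1 - 0 - (0 * 0) * 2^-1); last first.
    by rewrite expR0; ring.
  apply: cvgB; last by apply: cvgM (cvg_cst _); apply: cvgM.
  apply: cvgB; last exact: cvg_id.
  by apply: cvgB (cvg_cst _); exact: continuous_expR.
- rewrite -[X in _ --> X](mulr0 (0 : R)).
  by apply: cvgM.
- move=> x; rewrite inE/= => -[_ /eqP x0]; rewrite mulf_neq0//.
- apply/cvgr0Pnorm_lt => /= e e0.
  have id0 : x @[x --> (0 : R)] --> (0 : R) by exact: cvg_id.
  near=> x.
  have x2 : x <= 2^-1.
    by apply: ltW; near: x; apply: (cvgr_lt _ id0); rewrite invr_gt0.
  have xe : `|x| < e by near: x; move/cvgr0Pnorm_lt : id0; exact.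
  have [->|x0] := eqVneq x 0; first by rewrite mulr0 invr0 mulr0 normr0.
  apply: le_lt_trans xe.
  have /andP[d0 d1] := expR_taylor1 x2.
  rewrite normrM normfV (ger0_norm d0) ler_pdivrMr ?normr_gt0 ?mulf_neq0//.
  by rewrite normrM ger0_norm// mulrCA -expr2 real_normK ?num_real.
Unshelve. all: by end_near. Qed.

Lemma expands2_expR h f a b c : h n @[n --> \oo] --> 0 ->
  expands2 h f a b c ->
  expands2 h (fun n => expR (f n)) (expR a) (expR a * b)
    (expR a * (c + b ^+ 2 / 2)).
Proof.
move=> h0 [g gc fE].
(* As x / 0 = 0, [r 0] is 1/2, the limit of [r] at 0; so [r] may be composed with a null sequence
   that is allowed to vanish. *)
pose r t := 2^-1 + (expR t - 1 - t - t ^+ 2 / 2) / t ^+ 2 : R.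
have rE t : expR t = 1 + t + t ^+ 2 * r t.
  rewrite /r; have [->|t0] := eqVneq t 0; first by rewrite expR0; ring.
  by field.
have r0 : r t @[t --> 0] --> (2^-1 : R).
  rewrite -[X in _ --> X]addr0; apply: (cvgD (cvg_cst _)).
  apply/cvgr0Pnorm_lt => e e0.
  move/cvgr0Pnorm_lt : cvg_expR_taylor2 => /(_ e e0).
  rewrite near_withinE => te; near=> t; have te' := near te t.
  by have [->|/te'->//] := eqVneq t 0; rewrite (@expr0n _ 2)/= invr0 mulr0 normr0.
pose y n := b + h n * g n.
have yb : y n @[n --> \oo] --> b.
  rewrite -[X in _ --> X]addr0 -(mul0r c).
  by apply: cvgD; [exact: cvg_cst | exact: cvgM].
have hy0 : h n * y n @[n --> \oo] --> (0 : R).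
  by rewrite -(mul0r b); exact: cvgM.
exists (fun n => expR a * (g n + (y n * y n) * r (h n * y n))).
  apply: cvgMl_tmp; apply: cvgD => //; apply: cvgM; first exact: cvgM.
  exact: (cvg_comp _ _ hy0 r0).
near=> n; rewrite (near fE n)// -addrA expRD.
have -> : h n * b + h n ^+ 2 * g n = h n * y n by rewrite /y; ring.
rewrite (rE (h n * y n)); rewrite /y; ring.
Unshelve. all: by end_near. Qed.

(** For the lower bound, ln (1 - p) = - ln (1 + p / (1 - p)) >= - p / (1 - p), and p / (1 - p) - p =
    p^2 / (1 - p) <= 2 p^2. *)
Lemma ln1B_bounds (p : R) : `|p| <= 2^-1 -> - p - 2 * p ^+ 2 <= ln (1 - p) <= - p.
Proof.
rewrite ler_norml => /andP[p1 p2]; apply/andP; split; last first.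
  by apply: le_ln1Dx; lra.
have q0 : 0 < 1 - p by lra.
have -> : ln (1 - p) = - ln (1 + p / (1 - p)).
  have -> : 1 + p / (1 - p) = (1 - p)^-1 by field; lra.
  by rewrite lnV ?posrE// opprK.
have : ln (1 + p / (1 - p)) <= p / (1 - p).
  by apply: le_ln1Dx; rewrite ltr_pdivlMr//; lra.
have : p / (1 - p) <= p + 2 * p ^+ 2.
  by rewrite ler_pdivrMr//; nra.
lra.
Qed.

(** Write the power as exp(n ln(1 - p)). By [ln1B_bounds] the exponent differs from - n p by at most
    2 n p^2 = 2 (n p)^2 / n, which is o(h^2) because n p converges and 1 / (n h^2) tends to 0. *)
Lemma expands2_exprn_compl h p A B C :
  h n @[n --> \oo] --> 0 -> (\forall n \near \oo, h n != 0) ->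
  (n%:R * h n ^+ 2)^-1 @[n --> \oo] --> 0 ->
  expands2 h (fun n => n%:R * p n) A B C ->
  expands2 h (fun n => (1 - p n) ^+ n) (expR (- A)) (expR (- A) * - B)
    (expR (- A) * (- C + B ^+ 2 / 2)).
Proof.
move=> h0 hn0 nh0 ep; have npA := cvg_expands2 h0 ep.
have p0 : p n @[n --> \oo] --> 0.
  rewrite -(mulr0 A).
  have n0 : (n%:R : R)^-1 @[n --> \oo] --> (0 : R).
    by rewrite -cvg_shiftS; exact: cvg_harmonic.
  apply: cvg_trans (cvgM npA n0); apply: near_eq_cvg.
  near=> n; rewrite /= mulrAC mulfV ?mul1r// pnatr_eq0 -lt0n.
  by near: n; exact: nbhs_infty_gt.
have p2 : \forall n \near \oo, `|p n| <= 2^-1.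
  by apply: (cvgr_norm_le _ p0); rewrite normr0 invr_gt0.
pose e n := (n%:R * ln (1 - p n) + n%:R * p n) / h n ^+ 2.
have e0 : e n @[n --> \oo] --> 0.
  pose q n := 2 * ((n%:R * p n) * (n%:R * p n) * (n%:R * h n ^+ 2)^-1).
  have q0 : q n @[n --> \oo] --> 0.
    rewrite -(mulr0 (2 : R)) -(mulr0 (A * A)).
    by apply: cvgMl_tmp; apply: cvgM nh0; apply: cvgM.
  apply: (@squeeze_cvgr _ _ _ _ (fun n => - q n) q) => //; last first.
    by rewrite -oppr0; exact: cvgN.
  near=> n.
  have n0 : 0 < n%:R :> R by rewrite ltr0n; near: n; exact: nbhs_infty_gt.
  have hn : h n != 0 by near: n.
  have h2 : 0 < h n ^+ 2 by rewrite exprn_even_gt0.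
  have pn : `|p n| <= 2^-1 by near: n.
  have /andP[l1 l2] := ln1B_bounds pn.
  have -> : q n = n%:R * (2 * p n ^+ 2) / h n ^+ 2.
    by rewrite /q; field; rewrite hn (gt_eqF n0).
  rewrite /e -mulNr; apply/andP; split; rewrite ler_pM2r ?invr_gt0//; nra.
apply: (@eq_expands2 _ _ (fun n => expR (n%:R * ln (1 - p n))) _ _ _ _ _ _ _ _ erefl).
- near=> n; rewrite expRM_natl lnK// posrE.
  have : `|p n| <= 2^-1 by near: n.
  by rewrite ler_norml => /andP[]; lra.
- reflexivity.
- by rewrite -(sqrrN B).
apply: expands2_expR => //.
case: ep => g gC nE; exists (fun n => - g n + e n).
  by rewrite -[X in _ --> X]addr0; apply: cvgD => //; exact: cvgN.
near=> n; have : n%:R * ln (1 - p n) = e n * h n ^+ 2 - n%:R * p n.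
  by rewrite divfK; [ring | rewrite expf_neq0//; near: n].
by move=> ->; rewrite (near nE n)//; ring.
Unshelve. all: by end_near. Qed.
End exponential.

(** * Moments and tails of the normal distribution *)

Section normal_density_calculus.
Context {R : realType}.
Local Notation mu := (@lebesgue_measure R).
Implicit Types (m s z : R).

Lemma normal_pdf_expE m s : s != 0 -> normal_pdf m s =
  fun z => normal_peak s * expR (- (z - m) ^+ 2 / (s ^+ 2 *+ 2)).
Proof. exact: normal_pdfE. Qed.

Lemma is_derive_normal_pdf m s z : s != 0 ->
  is_derive z 1 (normal_pdf m s) (- ((z - m) / s ^+ 2) * normal_pdf m s z).
Proof.
move=> s0; rewrite normal_pdf_expE//.
have dE : is_derive z 1 (fun z => - (z - m) ^+ 2 / (s ^+ 2 *+ 2))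
    (- ((z - m) / s ^+ 2)).
  by apply: is_derive_eq; rewrite /GRing.scale/= -mulr_natr; field.
have := is_derive1_comp (is_derive_expR _) dE.
move=> dC; apply: (is_derive_eq (is_deriveZ (normal_peak s) dC)).
by rewrite /GRing.scale/=; ring.
Qed.

(** With y = z - m and |y| > 1, the affine factor is at most (|a| + |b|) |y| and the exponential at
    most 2 s^2 / y^2, so the product is O(1 / |y|). The filter is left abstract to serve both
    infinities. *)
Lemma cvg_affine_normal_pdf0 (G : set_system R) (FG : Filter G) m s (a b : R) :
  s != 0 -> (forall M, \forall z \near G, M < `|z - m|) ->
  ((z - m) * a + b) * normal_pdf m s z @[z --> G] --> 0.
Proof.
move=> s0 Gy; apply/cvgr0Pnorm_lt => e e0.
have pk := normal_peak_gt0 s0.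
have s2 : 0 < s ^+ 2 by rewrite exprn_even_gt0.
pose K := (`|a| + `|b|) * normal_peak s * (2 * s ^+ 2).
near=> z.
have y1 : 1 < `|z - m| by near: z.
have yK : K / e < `|z - m| by near: z.
have y0 : 0 < `|z - m| by apply: lt_trans y1.
rewrite normrM (ger0_norm (normal_pdf_ge0 _ _ _)) normal_pdf_expE//.
apply: (@le_lt_trans _ _ (K / `|z - m|)); last first.
  by rewrite ltr_pdivrMr// mulrC -ltr_pdivrMr.
have b1 : `|(z - m) * a + b| <= (`|a| + `|b|) * `|z - m|.
  apply: le_trans (ler_normD _ _) _; rewrite normrM.
  have := normr_ge0 b; nra.
have b2 : expR (- (z - m) ^+ 2 / (s ^+ 2 *+ 2)) <= 2 * s ^+ 2 / `|z - m| ^+ 2.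
  rewrite mulNr expRN -[leRHS]invrK lef_pV2 ?posrE ?expR_gt0//; last first.
    by rewrite invr_gt0 divr_gt0 ?exprn_gt0// mulr_gt0.
  apply: le_trans (expR_ge1Dx _).
  rewrite invf_div real_normK ?num_real// -mulr_natl; lra.
apply: (@le_trans _ _ ((`|a| + `|b|) * `|z - m| *
    (normal_peak s * (2 * s ^+ 2 / `|z - m| ^+ 2)))).
  by apply: ler_pM => //; rewrite ?mulr_ge0 ?expR_ge0 ?ler_pM2l// ltW.
rewrite le_eqVlt; apply/orP; left; apply/eqP; rewrite /K; field.
by rewrite gt_eqF.
Unshelve. all: by end_near. Qed.

Lemma near_pinfty_norm_gt m M : \forall z \near +oo, M < `|z - m|.
Proof.
near=> z; apply: lt_le_trans (ler_norm _).
by rewrite ltrBrDr; near: z; apply: nbhs_pinfty_gt; rewrite num_real.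
Unshelve. all: by end_near. Qed.

Lemma near_ninfty_norm_gt m M : \forall z \near -oo, M < `|z - m|.
Proof.
near=> z; rewrite distrC; apply: lt_le_trans (ler_norm _).
by rewrite ltrBrDl -ltrBrDr; near: z; apply: nbhs_ninfty_lt; rewrite num_real.
Unshelve. all: by end_near. Qed.

(** The line is cut at 0 and the left half reflected onto the right one, where - F(-z) is an
    antiderivative. *)
Lemma ge0_integralT_FTC2 (f F : R -> R) (l L : R) :
  (forall z, 0 <= f z) -> continuous f -> (forall z, is_derive z 1 F (f z)) ->
  F z @[z --> -oo] --> l -> F z @[z --> +oo] --> L ->
  (\int[mu]_z (f z)%:E = (L - l)%:E)%E.
Proof.
move=> f0 cf dF Fl FL.
have cF : continuous F.
  move=> z; apply: differentiable_continuous; apply/derivable1_diffP.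
  by have [] := dF z.
have mf : measurable_fun [set: R] f by exact: continuous_measurable_fun.
have cfN : continuous (f \o -%R).
  by move=> z; apply: continuous_comp; [exact: opp_continuous|exact: cf].
have dG z : is_derive z 1 (fun z => - F (- z)) ((f \o -%R) z).
  have := is_deriveN (is_derive1_comp (dF (- z)) (is_deriveN (is_derive_id z 1))).
  by move=> dC; apply: (is_derive_eq dC); rewrite /=; ring.
rewrite -(setUv `]-oo, (0 : R)]) ge0_integral_setU//=; last 4 first.
- exact: measurableC.
- by apply/measurable_EFinP; rewrite setUv.
- by move=> z _; rewrite lee_fin.
- exact/disj_setPCl.
rewrite setCitvl integral_itv_obnd_cbnd; last exact/measurable_EFinP/measurable_funTS.
rewrite -{1}oppr0 ge0_integration_by_substitutionNy//; last exact: continuous_subspaceT.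
rewrite (@ge0_continuous_FTC2y _ _ (fun z => - F (- z)) 0 (- l)); last 6 first.
- by move=> x _; exact: f0.
- exact: continuous_subspaceT.
- by apply: cvgN; apply/cvgNy_compNP.
- by move=> x _; have [] := dG x.
- apply: cvg_at_right_filter; apply: cvgN; apply: continuous_comp (cF _).
  exact: opp_continuous.
- by move=> x _; rewrite derive1E; have [_ ->] := dG x.
rewrite (@ge0_continuous_FTC2y _ _ F 0 L); last 6 first.
- by move=> x _; exact: f0.
- exact: continuous_subspaceT.
- exact: FL.
- by move=> x _; have [] := dF x.
- exact/cvg_at_right_filter/cF.
- by move=> x _; rewrite derive1E; have [_ ->] := dF x.
rewrite oppr0 -!EFinB -EFinD; congr EFin; ring.
Qed.
End normal_density_calculus.

(** * Second moments of the normal law *)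

Section normal_moments.
Context {R : realType}.
Local Notation mu := (@lebesgue_measure R).
Implicit Types (m s c z : R).

(** The Radon-Nikodym derivative of [normal_prob] has the same integral as [normal_pdf] over every
    measurable set, hence equals it almost everywhere. *)
Lemma ge0_integral_normal_prob m s (f : R -> R) :
  measurable_fun [set: R] f -> (forall z, 0 <= f z) ->
  (\int[normal_prob m s]_z (f z)%:E =
   \int[mu]_z (f z * normal_pdf m s z)%:E)%E.
Proof.
move=> mf f0; have dom := normal_prob_dominates m s.
rewrite -(Radon_Nikodym_SigmaFinite.change_of_variables dom)//; last first.
  exact/measurable_EFinP.
have iRN := Radon_Nikodym_SigmaFinite.f_integrable dom.
have mpdf : measurable_fun [set: R] (EFin \o normal_pdf m s).
  by apply/measurable_EFinP; exact: measurable_normal_pdf.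
under [in RHS]eq_integral do rewrite EFinM.
apply: ae_eq_integral => //.
- apply: emeasurable_funM; first exact/measurable_EFinP.
  exact: measurable_int iRN.
- by apply: emeasurable_funM => //; exact/measurable_EFinP.
- apply: ae_eqe_mul2l; apply: integral_ae_eq => //=.
  by move=> E _ mE; rewrite -Radon_Nikodym_SigmaFinite.f_integral.
Qed.

(** The identity as a random variable makes the limits of distribution functions applicable to
    [normal_prob] itself. *)
Let idTR : measurableTypeR R -> R := idfun.
HB.instance Definition _ :=
  @isMeasurableFun.Build _ _ _ _ idTR (@measurable_id _ _ setT).

Definition normal_cdf m s z : R := fine (normal_prob m s `]-oo, z]).

Lemma cvg_normal_cdfy m s : normal_cdf m s z @[z --> +oo%R] --> (1 : R).
Proof. exact: fine_cvg (@cvg_cdfy1 _ _ _ (normal_prob m s) idTR). Qed.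

Lemma cvg_normal_cdfNy m s : normal_cdf m s z @[z --> -oo%R] --> (0 : R).
Proof. exact: fine_cvg (@cvg_cdfNy0 _ _ _ (normal_prob m s) idTR). Qed.

Lemma is_derive_normal_cdf m s z : s != 0 ->
  is_derive z 1 (normal_cdf m s) (normal_pdf m s z).
Proof.
move=> s0.
have [||||dN dNE] := @continuous_FTC1 R (normal_pdf m s) -oo%O z (z + 1).
- by rewrite ltrDl.
- by apply: integrableS (integrable_normal_pdf m s).
- by rewrite ltNyr.
- exact: continuous_normal_pdf.
by apply: (DeriveDef dN); rewrite -derive1E; exact: dNE.
Qed.

(* The second moments about all [c] determine both [m] and [s], so first
   moments, whose integrands change sign, are never computed. *)
Lemma normal_second_moment m s c : s != 0 ->
  (\int[normal_prob m s]_z ((z - c) ^+ 2)%:E = (s ^+ 2 + (m - c) ^+ 2)%:E)%E.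
Proof.
move=> s0; rewrite ge0_integral_normal_prob; last 2 first.
- by apply: measurable_funX; exact: measurable_funB.
- by move=> z; exact: sqr_ge0.
pose v := s ^+ 2 + (m - c) ^+ 2.
(* Obtained by expanding (z - c)^2 around m and integrating by parts, using (z - m) pdf = - s^2
   pdf'. *)
pose F z := v * normal_cdf m s z +
  ((z - m) * (- s ^+ 2) + (- 2 * (m - c) * s ^+ 2)) * normal_pdf m s z.
have dF z : is_derive z 1 F ((z - c) ^+ 2 * normal_pdf m s z).
  have dN := is_derive_normal_cdf m z s0; have dp := is_derive_normal_pdf m z s0.
  rewrite /F; apply: is_derive_eq; rewrite /GRing.scale/= /v; field.
  by rewrite s0.
rewrite (@ge0_integralT_FTC2 R (fun z => (z - c) ^+ 2 * normal_pdf m s z) F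
  (v * 0 + 0) (v * 1 + 0) _ _ dF).
- by congr EFin; rewrite /v; ring.
- by move=> z; rewrite mulr_ge0 ?sqr_ge0 ?normal_pdf_ge0.
- move=> z; apply: cvgM; last exact: continuous_normal_pdf.
  by apply: cvgM; apply: cvgB (cvg_cst _).
- apply: cvgD; first by apply: cvgMl_tmp; exact: cvg_normal_cdfNy.
  by apply: cvg_affine_normal_pdf0 => //; exact: near_ninfty_norm_gt.
- apply: cvgD; first by apply: cvgMl_tmp; exact: cvg_normal_cdfy.
  by apply: cvg_affine_normal_pdf0 => //; exact: near_pinfty_norm_gt.
Qed.
End normal_moments.

(** * Gaussian tails and the Mills ratio *)

Section normal_tail.
Context {R : realType}.
Local Notation mu := (@lebesgue_measure R).
Local Notation phi := (normal_pdf (0 : R) 1).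
Implicit Types (s u w z : R).

Lemma continuous_invX (n : nat) z : z != 0 ->
  {for z, continuous (fun t : R => t^-1 ^+ n)}.
Proof.
move=> z0.
exact: (cvg_comp _ (fun t : R => t ^+ n) (inv_continuous z0)
  (@exprn_continuous R n _)).
Qed.

Lemma ge0_integraly_FTC2 (f F : R -> R) u (l : R) :
  (forall z, u <= z -> [/\ 0 <= f z, {for z, continuous f} &
    is_derive z 1 F (f z)]) ->
  F z @[z --> +oo] --> l ->
  (\int[mu]_(z in `[u, +oo[) (f z)%:E = (l - F u)%:E)%E.
Proof.
move=> H Fl; rewrite EFinB; apply: ge0_continuous_FTC2y => //.
- by move=> z /H[].
- apply: continuous_in_subspaceT => z; rewrite inE/= in_itv/= andbT.
  by move=> /H[].
- by move=> z /ltW/H[_ _ []].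
- have [_ _ dF] := H u (lexx _).
  apply: cvg_at_right_filter; apply: differentiable_continuous.
  by apply/derivable1_diffP; case: dF.
- move=> z; rewrite in_itv/= andbT => /ltW/H[_ _ dF].
  by rewrite derive1E; case: dF.
Qed.

Lemma normal_prob_oy s u : (normal_prob 0 s `]u, +oo[ =
  \int[mu]_(z in `[u, +oo[) (normal_pdf 0 s z)%:E)%E.
Proof.
rewrite /normal_prob integral_itv_obnd_cbnd//.
by apply/measurable_EFinP/measurable_funTS; exact: measurable_normal_pdf.
Qed.

(* On [z >= w >= 1] the density is bounded by [z * normal_pdf 0 s z], which has
   an explicit antiderivative. *)
Lemma normal_tail_le s w : 0 < s -> s ^+ 2 <= 2 -> 1 <= w ->
  (normal_prob 0 s `]w, +oo[ <= (expR (- (w ^+ 2 / 4)))%:E)%E.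
Proof.
move=> s0 s2 w1; have w0 : 0 < w by apply: lt_le_trans w1.
have sn0 : s != 0 by rewrite gt_eqF.
rewrite normal_prob_oy.
have mf : measurable_fun `[w, +oo[ (fun z => z * normal_pdf 0 s z).
  by apply: measurable_funTS; apply: measurable_funM => //; exact: measurable_normal_pdf.
apply: (@le_trans _ _ (\int[mu]_(z in `[w, +oo[) (z * normal_pdf 0 s z)%:E)%E).
  apply: ge0_le_integral => //.
  - by move=> z _; rewrite lee_fin normal_pdf_ge0.
  - by apply/measurable_EFinP/measurable_funTS; exact: measurable_normal_pdf.
  - exact/measurable_EFinP.
  - move=> z; rewrite /= in_itv/= andbT => wz.
    by rewrite lee_fin ler_peMl ?normal_pdf_ge0// (le_trans w1).
(* The antiderivative - s^2 pdf is put in affine form to match [cvg_affine_normal_pdf0]. *)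
rewrite (@ge0_integraly_FTC2 _ (fun z => ((z - 0) * 0 - s ^+ 2) * normal_pdf 0 s z) w 0).
- rewrite lee_fin sub0r mulr0 sub0r mulNr opprK normal_pdf_expE// subr0.
  rewrite mulrA -[leRHS]mul1r; apply: ler_pM.
  + by rewrite mulr_ge0 ?sqr_ge0// normal_peak_ge0.
  + exact: expR_ge0.
  (* The prefactor s^2 / sqrt(2 pi s^2) is at most 1 since s^2 <= 2 <= pi. *)
  + rewrite /normal_peak ler_pdivrMr ?mul1r; last first.
      by rewrite sqrtr_gt0 mulrn_wgt0// mulr_gt0 ?pi_gt0// exprn_gt0.
    rewrite -[leLHS]ger0_norm ?sqr_ge0// -sqrtr_sqr ler_sqrt; last first.
      by rewrite mulrn_wge0// mulr_ge0 ?pi_ge0// sqr_ge0.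
    rewrite -mulr_natr; have := pi_ge2 R; have := sqr_ge0 s; nra.
  + rewrite ler_expR mulNr lerN2 ler_pM2l ?exprn_gt0// lef_pV2 ?posrE//.
      by rewrite -mulr_natl; lra.
    by rewrite -mulr_natl mulr_gt0// exprn_gt0.
- move=> z wz; split.
  + by rewrite mulr_ge0 ?normal_pdf_ge0// (le_trans _ wz)// ltW.
  + by apply: cvgM => //; exact: continuous_normal_pdf.
  + have dp := is_derive_normal_pdf 0 z sn0.
    apply: is_derive_eq; rewrite /GRing.scale/=; field.
    by rewrite sn0.
- by apply: cvg_affine_normal_pdf0 => //; exact: near_pinfty_norm_gt.
Qed.

(** The asymptotic series of the Mills ratio (1 - Phi(u)) / phi(u), cut after three terms. *)
Definition mills u : R := u^-1 - u^-1 ^+ 3 + 3 * u^-1 ^+ 5.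

(* The next terms of the asymptotic series are traded for the factor
   [1 + 15 / z ^ 6], for which [- phi * mills] is an exact antiderivative. *)
Lemma normal_tail_mills_integral u : 0 < u ->
  (\int[mu]_(z in `[u, +oo[) (phi z * (1 + 15 * z^-1 ^+ 6))%:E =
   (phi u * mills u)%:E)%E.
Proof.
move=> u0.
have H0 : 1 != 0 :> R by exact: oner_neq0.
rewrite (@ge0_integraly_FTC2 _ (fun z => - (phi z * mills z)) u 0).
- by rewrite sub0r opprK.
- move=> z uz; have z0 : z != 0 by rewrite gt_eqF// (lt_le_trans u0).
  split.
  + rewrite mulr_ge0 ?normal_pdf_ge0// addr_ge0// mulr_ge0// exprn_ge0//.
    by rewrite invr_ge0 (le_trans _ uz)// ltW.
  + apply: cvgM; first exact: continuous_normal_pdf.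
    by apply: cvgD (cvg_cst _) _; apply: cvgMl_tmp; exact: continuous_invX.
  + have dp := is_derive_normal_pdf 0 z H0.
    have di := is_deriveV z0 (is_derive_id z 1).
    rewrite /mills; apply: is_derive_eq; rewrite /GRing.scale/=; field.
    by [].
- rewrite -[X in _ --> X]oppr0; apply: cvgN; rewrite -[X in _ --> X](mulr0 (0 : R)).
  have phi0 : phi z @[z --> +oo%R] --> (0 : R).
    rewrite (_ : phi = fun z => ((z - 0) * 0 + 1) * phi z); last first.
      by apply/funext => z; rewrite mulr0 add0r mul1r.
    exact: (@cvg_affine_normal_pdf0 R +oo%R _ 0 1 0 1 H0 (near_pinfty_norm_gt 0)).
  have i0 : z^-1 @[z --> +oo%R] --> (0 : R).
    apply/gtr0_cvgV0 => //; near=> z; near: z.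
    by apply: nbhs_pinfty_gt; rewrite num_real.
  apply: cvgM.
    exact: phi0.
  rewrite [X in _ --> X](_ : _ = 0 - 0 ^+ 3 + 3 * 0 ^+ 5 :> R); last first.
    by rewrite !expr0n/=; ring.
  apply: cvgD.
    by apply: cvgB => //; exact: (continuous_cvg _ (@exprn_continuous R 3 0)).
  by apply: cvgMl_tmp; exact: (continuous_cvg _ (@exprn_continuous R 5 0)).
Unshelve. all: by end_near. Qed.

Lemma Phi_compl u : normal_prob (0 : R) 1 `]u, +oo[ = (1 - Phi u)%:E.
Proof.
have -> : `]u, +oo[%classic = ~` `]-oo, u] :> set R by rewrite setCitvl.
by rewrite probability_setC// /Phi EFinB fineK// fin_num_measure.
Qed.

(** On z >= u one has 1 <= 1 + 15/z^6 <= 1 + 15/u^6; integrate against phi. *)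
Lemma normal_tail_mills_bounds u : 0 < u ->
  1 - Phi u <= phi u * mills u <= (1 + 15 * u^-1 ^+ 6) * (1 - Phi u).
Proof.
move=> u0; rewrite -!lee_fin (EFinM (1 + _)) -Phi_compl -normal_tail_mills_integral//.
rewrite normal_prob_oy.
have mphi : measurable_fun `[u, +oo[ (EFin \o phi).
  by apply/measurable_EFinP/measurable_funTS; exact: measurable_normal_pdf.
have mf : measurable_fun `[u, +oo[ (fun z => (phi z * (1 + 15 * z^-1 ^+ 6))%:E).
  apply/measurable_EFinP; apply: subspace_continuous_measurable_fun => //.
  apply: continuous_in_subspaceT => z; rewrite inE/= in_itv/= andbT => uz.
  have z0 : z != 0 by rewrite gt_eqF// (lt_le_trans u0).
  apply: cvgM; first exact: continuous_normal_pdf.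
  by apply: cvgD (cvg_cst _) _; apply: cvgMl_tmp; exact: continuous_invX.
rewrite -ge0_integralZl//; last 2 first.
- by move=> z _; rewrite lee_fin normal_pdf_ge0.
- by rewrite lee_fin addr_ge0// mulr_ge0// exprn_ge0// invr_ge0 ltW.
apply/andP; split; apply: ge0_le_integral => //.
- by move=> z _; rewrite lee_fin normal_pdf_ge0.
- move=> z; rewrite /= in_itv/= andbT => uz; rewrite lee_fin ler_peMr ?normal_pdf_ge0//.
  by rewrite lerDl mulr_ge0// exprn_ge0// invr_ge0 (le_trans _ uz)// ltW.
- move=> z; rewrite /= in_itv/= andbT => uz; rewrite lee_fin mulr_ge0 ?normal_pdf_ge0//.
  by rewrite addr_ge0// mulr_ge0// exprn_ge0// invr_ge0 (le_trans _ uz)// ltW.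
- by apply: emeasurable_funM.
- move=> z; rewrite /= in_itv/= andbT => uz; rewrite -EFinM lee_fin mulrC.
  have z0 : 0 < z by apply: lt_le_trans uz.
  have zu : z^-1 <= u^-1 by rewrite lef_pV2 ?posrE.
  rewrite ler_wpM2r ?normal_pdf_ge0// lerD2l ler_pM2l//.
  by rewrite lerXn2r ?nnegrE ?invr_ge0 ?(ltW z0) ?(ltW u0).
Qed.

Lemma mills_gt0 u : 0 < u -> 0 < mills u.
Proof.
move=> u0; have : 0 < u^-1 by rewrite invr_gt0.
rewrite /mills; set k := u^-1 => k0.
(* The second factor is a quadratic in k^2 of negative discriminant. *)
have -> : k - k ^+ 3 + 3 * k ^+ 5 = k * (1 - k ^+ 2 + 3 * (k ^+ 2) ^+ 2) by ring.
by rewrite mulr_gt0//; nra.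
Qed.

(** For u > 0 the upper Mills bound puts a multiple of the tail above a positive number;
    monotonicity of [Phi] covers the other u. *)
Lemma Phi_lt1 u : Phi u < 1.
Proof.
wlog u0 : u / 0 < u => [H|].
  apply: le_lt_trans (H (Num.max u 1) _); last by rewrite lt_max ltr01 orbT.
  rewrite /Phi fine_le ?fin_num_measure// le_measure ?inE//.
  by apply: subset_itvl; rewrite bnd_simp le_max lexx.
have /andP[_ ub] := normal_tail_mills_bounds u0.
have : 0 < phi u * mills u.
  rewrite mulr_gt0 ?mills_gt0// normal_pdf_expE ?oner_neq0//.
  by rewrite mulr_gt0 ?expR_gt0 ?normal_peak_gt0 ?oner_neq0.
move=> /lt_le_trans/(_ ub); rewrite pmulr_rgt0 ?subr_gt0//.
by rewrite ltr_pwDl// mulr_ge0// exprn_ge0// invr_ge0 ltW.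
Qed.

(** The relative error of the Mills approximation. Its order u^-6 lies beyond h^2 = b_n^-4, so it
    never enters the coefficients. *)
Definition mills_error u : R := phi u * mills u / (1 - Phi u) - 1.

Lemma mills_error_bounds u : 0 < u -> 0 <= mills_error u <= 15 * u^-1 ^+ 6.
Proof.
move=> u0; have /andP[lb ub] := normal_tail_mills_bounds u0.
have t0 : 0 < 1 - Phi u by rewrite subr_gt0 Phi_lt1.
rewrite /mills_error; apply/andP; split.
  by rewrite subr_ge0 ler_pdivlMr ?mul1r.
by rewrite lerBlDl ler_pdivrMr.
Qed.

Lemma normal_tail_mills u : 0 < u ->
  1 - Phi u = phi u * mills u / (1 + mills_error u).
Proof.
move=> u0; have t0 : 0 < 1 - Phi u by rewrite subr_gt0 Phi_lt1.
have f0 : 0 < phi u * mills u.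
  have /andP[lb _] := normal_tail_mills_bounds u0; exact: lt_le_trans lb.
by rewrite /mills_error addrCA subrr addr0 invf_div mulrC divfK// gt_eqF.
Qed.

End normal_tail.

(** * Gaussian vectors *)

Section centered_gaussian.
Context {d : measure_display} {T : measurableType d} {R : realType}.
Variable P : probability T R.
Implicit Types (v c : R).
Local Open Scope ereal_scope.

Lemma Lfun2_sqr_integral (X : {RV P >-> R}) :
  \int[P]_w ((X w) ^+ 2)%:E < +oo -> (X : T -> R) \in Lfun P 2%:E.
Proof.
move=> fin; rewrite inE; apply/andP; split; rewrite inE/=; first by [].
rewrite /finite_norm unlock /=.
apply: poweR_lty.
apply: le_lt_trans fin; rewrite le_eqVlt; apply/orP; left; apply/eqP.
by apply: eq_integral => w _ /=; rewrite powR_mulrn// real_normK// num_real.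
Qed.

Lemma centered_second_moment (Z : T -> R) v c :
  Z \in Lfun P 2%:E -> 'E_P[Z] = 0 -> 'V_P[Z] = v%:E ->
  \int[P]_w ((Z w - c) ^+ 2)%:E = (v + c ^+ 2)%:E.
Proof.
move=> Z2 EZ VZ.
have Pfin : P [set: T] \is a fin_num := fin_num_measure P _ measurableT.
have Z1 := Lfun_subset12 Pfin Z2.
have : 'V_P[Z \- cst c]%R = v%:E by rewrite varianceB_cst_r.
rewrite varianceE; last first.
  rewrite rpredB ?lee1n//= => _; exact: Lfun_cst.
rewrite expectationB ?Lfun_cst// EZ expectation_cst sub0e.
rewrite unlock /= mulrNN.
case: (\int[P]_w _) => [r||//] // [<-].
by congr EFin; rewrite expr2 subrK.
Qed.

(** Taking s = 0 for the point mass gives both kinds of Gaussian law the same second-moment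
    formula. *)
Lemma gaussian_second_moment (Z : T -> R) : measurable_fun [set: T] Z ->
  gaussian P Z -> exists m s : R, [/\ (0 <= s)%R,
    forall A, measurable A -> pushforward P Z A =
      if s == 0%R then \d_m A else normal_prob m s A &
    forall c, \int[P]_w ((Z w - c) ^+ 2)%:E = (s ^+ 2 + (m - c) ^+ 2)%:E].
Proof.
move=> mZ.
(* [normal_prob] lives on [measurableTypeR R], whose display differs from the
   default one carried by [R]. *)
have mZ' : @measurable_fun _ _ T (measurableTypeR R) [set: T] Z by exact: mZ.
pose Z' : {mfun T >-> measurableTypeR R} :=
  @mfun_Sub _ _ T (measurableTypeR R) Z (mem_set mZ').
have sq (c : R) : measurable_fun [set: measurableTypeR R] (fun z => ((z - c) ^+ 2)%:E).
  apply/measurable_EFinP; apply: measurable_funX; exact: measurable_funB.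
have tr c : \int[P]_w ((Z w - c) ^+ 2)%:E =
    \int[distribution P Z']_z ((z - c) ^+ 2)%:E.
  by rewrite ge0_integral_distribution// => z; rewrite lee_fin sqr_ge0.
case=> [[m mE]|[m [s [s0 msE]]]].
  exists m, 0%R; split=> [//||c]; first by move=> A mA; rewrite eqxx mE.
  rewrite tr; pose dm := @dirac _ (measurableTypeR R) m R.
  transitivity (\int[dm]_z ((z - c) ^+ 2)%:E).
    apply: (@eq_measure_integral _ (measurableTypeR R) R setT dm
      (distribution P Z')) => A mA _; exact: mE.
  by rewrite integral_dirac// diracT mul1e expr0n/= add0r.
exists m, s; split=> [|A mA|c]; first exact: ltW.
  by rewrite gt_eqF// msE.
have sn0 : s != 0%R by rewrite gt_eqF.
rewrite tr -(normal_second_moment m c sn0).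
apply: (@eq_measure_integral _ (measurableTypeR R) R setT (normal_prob m s)
  (distribution P Z')) => A mA _; exact: msE.
Qed.

Lemma gaussian_centered_law (Z : T -> R) v : Z \in Lfun P 2%:E ->
  gaussian P Z -> 'E_P[Z] = 0 -> 'V_P[Z] = v%:E -> (0 <= v)%R /\
  forall A, measurable A -> pushforward P Z A =
    if v == 0%R then \d_(0%R : R) A else normal_prob 0 (Num.sqrt v) A.
Proof.
move=> Z2 gZ EZ VZ.
have mZ : measurable_fun [set: T] Z.
  by move: Z2; rewrite inE => /andP[+ _]; rewrite inE.
have [m [s [s0 law moment]]] := gaussian_second_moment mZ gZ.
have eqm c : (v + c ^+ 2 = s ^+ 2 + (m - c) ^+ 2)%R.
  by apply: EFin_inj; rewrite -moment -(centered_second_moment c Z2 EZ VZ).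
(* Subtracting the identities at c = 0 and c = 1 gives m = 0, and then v = s^2. *)
have := eqm 0%R; have := eqm 1%R; rewrite subr0 => e1 e0.
have m0 : m = 0%R by nra.
have vE : v = (s ^+ 2)%R by rewrite m0 in e0; lra.
split=> [|A mA]; first by rewrite vE sqr_ge0.
by rewrite (law _ mA) m0 vE sqrf_eq0 sqrtr_sqr (ger0_norm s0).
Qed.
End centered_gaussian.

(** * Linear combinations and the joint distribution function *)

Section bivariate.
Context {R : realType}.
Implicit Types (rho x y : R) (G : R -> R -> R).

Lemma linear_combination_law {d : measure_display} {T : measurableType d}
    (P : probability T R) (X Y : {RV P >-> R}) rho (a b : R) :
  gaussian_vector X Y -> ('E_P[X] = 0 /\ 'E_P[Y] = 0)%E ->
  ('V_P[X] = 1 /\ 'V_P[Y] = 1)%E -> correlation X Y = rho ->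
  let v := a ^+ 2 + b ^+ 2 + 2 * (a * b * rho) in 0 <= v /\
  forall A, measurable A -> P [set w | A (a * X w + b * Y w)] =
    if v == 0 then \d_(0 : R) A else normal_prob 0 (Num.sqrt v) A.
Proof.
move=> gXY [EX EY] [VX VY] cXY v.
have Pfin : P [set: T] \is a fin_num := fin_num_measure P _ measurableT.
have L2 (Z : {RV P >-> R}) : ('E_P[Z] = 0)%E -> ('V_P[Z] = 1)%E ->
    (Z : T -> R) \in Lfun P 2%:E.
  move=> EZ; rewrite /variance unlock EZ unlock /= => VZ.
  apply: Lfun2_sqr_integral; apply: (@le_lt_trans _ _ 1%E); last exact: ltry.
  rewrite -VZ le_eqVlt; apply/orP; left; apply/eqP.
  by apply: eq_integral => w _; rewrite expr2 -[in LHS](subr0 (Z w)).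
have X2 := L2 X EX VX; have Y2 := L2 Y EY VY.
have X1 := Lfun_subset12 Pfin X2; have Y1 := Lfun_subset12 Pfin Y2.
(* Both standard deviations are 1, and the covariance of square-integrable variables is finite, so
   [fine] loses nothing. *)
have cov : covariance P X Y = rho%:E.
  rewrite -cXY /correlation VX VY /= sqrtr1 mulr1 divr1 fineK//.
  by rewrite covariance_fin_num// Lfun2_mul_Lfun1.
have aX2 : a \o* X \in Lfun P 2%:E by rewrite Lfun_scale// ler1n.
have bY2 : b \o* Y \in Lfun P 2%:E by rewrite Lfun_scale// ler1n.
have ZE : (fun w => a * X w + b * Y w) = (a \o* X \+ b \o* Y)%R.
  by apply/funext => w /=; rewrite mulrC [b * _]mulrC.
have Z2 : (fun w => a * X w + b * Y w) \in Lfun P 2%:E.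
  by rewrite ZE rpredD ?lee1n.
have EZ : ('E_P[fun w => (a * X w + b * Y w)%R] = 0)%E.
  rewrite ZE expectationD ?Lfun_scale//.
  by rewrite !expectationZl// EX EY !mule0 adde0.
have VZ : ('V_P[fun w => (a * X w + b * Y w)%R] = v%:E)%E.
  rewrite ZE varianceD// !varianceZ// VX VY covarianceZl ?Lfun_scale ?Lfun2_mul_Lfun1//.
  rewrite covarianceZr ?Lfun2_mul_Lfun1// cov !mule1 -!EFinM -!EFinD; congr EFin.
  by rewrite /v; ring.
exact: (gaussian_centered_law Z2 (gXY a b) EZ VZ).
Qed.

Section marginals.
Context {d : measure_display} {T : measurableType d} (P : probability T R).
Variables (X Y : {RV P >-> R}) (rho : R).
Hypotheses (gXY : gaussian_vector X Y) (EXY : ('E_P[X] = 0 /\ 'E_P[Y] = 0)%E)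
  (VXY : ('V_P[X] = 1 /\ 'V_P[Y] = 1)%E) (cXY : correlation X Y = rho).

Let mXle x : measurable [set w | X w <= x].
Proof.
rewrite -[X in measurable X]setTI.
have -> : [set w | X w <= x] = X @^-1` `]-oo, x].
  by apply/seteqP; split=> w; rewrite /= in_itv.
exact: measurable_funP.
Qed.

Let mYle y : measurable [set w | Y w <= y].
Proof.
rewrite -[X in measurable X]setTI.
have -> : [set w | Y w <= y] = Y @^-1` `]-oo, y].
  by apply/seteqP; split=> w; rewrite /= in_itv.
exact: measurable_funP.
Qed.

Let mlin a b (A : set R) : measurable A ->
  measurable [set w | A (a * X w + b * Y w)].
Proof.
move=> mA; rewrite -[X in measurable X]setTI.
apply: (_ : measurable_fun setT (fun w => a * X w + b * Y w)) => //.
by apply: measurable_funD; apply: measurable_funM.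
Qed.

Let PX x : P [set w | X w <= x] = (Phi x)%:E.
Proof.
have [_ /(_ `]-oo, x]%classic (measurable_itv _))] :=
  linear_combination_law 1 0 gXY EXY VXY cXY.
rewrite !(mulr0, mul0r, expr0n, expr1n, addr0)/= oner_eq0 sqrtr1.
rewrite /Phi fineK ?fin_num_measure// => <-; congr (P _).
by apply/seteqP; split=> w; rewrite /= in_itv/= mul0r mul1r addr0.
Qed.

Let PY y : P [set w | Y w <= y] = (Phi y)%:E.
Proof.
have [_ /(_ `]-oo, y]%classic (measurable_itv _))] :=
  linear_combination_law 0 1 gXY EXY VXY cXY.
rewrite !(mulr0, mul0r, expr0n, expr1n, addr0, add0r)/= oner_eq0 sqrtr1.
rewrite /Phi fineK ?fin_num_measure// => <-; congr (P _).
by apply/seteqP; split=> w; rewrite /= in_itv/= mul0r mul1r add0r.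
Qed.

(** X - Y has variance 1 + 1 - 2 = 0, so its law is the point mass at 0; the two events then differ
    only inside the null set [N] where X and Y disagree. *)
Lemma joint_cdf_perfect_correlation x y : rho = 1 ->
  joint_cdf X Y x y = Phi (Num.min x y).
Proof.
move=> rho1.
have [_ /(_ (~` [set 0]) (measurableC (measurable_set1 0)))] :=
  linear_combination_law 1 (-1) gXY EXY VXY cXY.
have -> : 1 ^+ 2 + (-1) ^+ 2 + 2 * (1 * -1 * rho) = 0 :> R by rewrite rho1; ring.
rewrite eqxx diracE memNset/=; last by apply.
set N := [set w | _] => P0.
have mN : measurable N by exact: mlin (measurableC (measurable_set1 0)).
have XY w : ~ N w -> X w = Y w by move=> /contrapT; rewrite /=; lra.
have eqP A B : measurable A -> measurable B ->
    A `<=` B `|` N -> B `<=` A `|` N -> P A = P B.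
  have leP C D : measurable C -> measurable D -> C `<=` D `|` N -> (P C <= P D)%E.
    move=> mC mD CD; rewrite -(measureU0 mD mN P0).
    by apply: le_measure => //; rewrite inE//; exact: measurableU.
  by move=> mA mB AB BA; apply/eqP; rewrite eq_le !leP.
rewrite /joint_cdf (eqP _ [set w | X w <= Num.min x y]).
- by rewrite PX.
- exact: measurableI (mXle x) (mYle y).
- exact: mXle.
- move=> w [Xx Yy]; have [Nw|/XY XYw] := pselect (N w); [by right|left].
  by rewrite /= le_min Xx XYw.
- move=> w; rewrite /= le_min => /andP[Xx Xy].
  by have [Nw|/XY XYw] := pselect (N w); [right|left; rewrite /= -XYw].
Qed.

(** By inclusion-exclusion the gap is P(X > x, Y > y), at most P(X + Y > x + y), and X + Y has
    variance 2 + 2 rho <= 2, as [normal_tail_le] requires. *)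
Lemma joint_cdf_gap x y : rho <= 0 -> 1 <= x + y ->
  0 <= joint_cdf X Y x y - (Phi x + Phi y - 1) <= expR (- ((x + y) ^+ 2 / 4)).
Proof.
move=> rho0 xy1.
pose A := [set w | X w <= x]; pose B := [set w | Y w <= y].
have PU : (P (A `|` B) = (Phi x)%:E + (Phi y)%:E - (joint_cdf X Y x y)%:E)%E.
  have fin := fin_num_measure P _ (measurableI _ _ (mXle x) (mYle y)).
  rewrite -PX -PY /joint_cdf (fineK fin).
  by apply: measureUfinl (mXle x) (mYle y) _; rewrite [ltLHS]PX ltry.
have mAB : measurable (A `|` B) := measurableU _ _ (mXle x) (mYle y).
have PC : (P (~` (A `|` B)) =
    (joint_cdf X Y x y - (Phi x + Phi y - 1))%:E)%E.
  rewrite probability_setC// PU.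
  transitivity ((1 - (Phi x + Phi y - joint_cdf X Y x y))%:E) => //.
  by congr EFin; ring.
apply/andP; split; first by rewrite -lee_fin -PC.
rewrite -lee_fin -PC.
have [v0 /(_ `]x + y, +oo[%classic (measurable_itv _)) law] :=
  linear_combination_law 1 1 gXY EXY VXY cXY.
set v := (X in 0 <= X) in v0 law.
apply: (@le_trans _ _ (P [set w | `]x + y, +oo[%classic (1 * X w + 1 * Y w)])).
  apply: le_measure; rewrite ?inE.
  - exact: measurableC.
  - exact: mlin.
  - move=> w /= /not_orP[/negP + /negP]; rewrite -!ltNge !mul1r in_itv/= andbT.
    exact: ltrD.
(* If the variance vanishes, X + Y is almost surely 0 and cannot exceed x + y >= 1. *)
rewrite law; have [_|vn0] := eqVneq v 0.
  rewrite diracE memNset ?lee_fin ?expR_ge0//= in_itv/= andbT.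
  by apply/negP; rewrite -leNgt (le_trans _ xy1).
apply: normal_tail_le => //.
  by rewrite sqrtr_gt0 lt_neqAle eq_sym vn0.
by rewrite sqr_sqrtr// /v; lra.
Qed.
End marginals.

Lemma gaussian_cdf1 G x y : gaussian_cdf 1 G -> G x y = Phi (Num.min x y).
Proof.
move=> [d [T [P [X [Y [gXY EXY VXY cXY ->]]]]]].
exact: joint_cdf_perfect_correlation gXY EXY VXY cXY _ _ _.
Qed.

Lemma gaussian_cdf_gap rho G x y : gaussian_cdf rho G -> rho <= 0 -> 1 <= x + y ->
  0 <= G x y - (Phi x + Phi y - 1) <= expR (- ((x + y) ^+ 2 / 4)).
Proof.
move=> [d [T [P [X [Y [gXY EXY VXY cXY ->]]]]]].
exact: joint_cdf_gap gXY EXY VXY cXY _ _.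
Qed.

End bivariate.

(** * The norming constants *)

Section norming.
Context {R : realType}.

Definition inv_sqr (b : nat -> R) n : R := (b n)^-1 ^+ 2.

Variable b : nat -> R.
Hypothesis hb : forall n : nat, (3 <= n)%N -> n%:R * (1 - Phi (b n)) = 1.
Local Notation phi := (normal_pdf (0 : R) 1).
Implicit Types (x y u v : R).

Local Notation h := (inv_sqr b).

(** If b_n < M, then 1/n = 1 - Phi(b_n) >= 1 - Phi(M) > 0, which fails for large n. *)
Lemma norming_cvgy : b n @[n --> \oo] --> +oo%R.
Proof.
apply/cvgryPge => M; have M1 : 0 < 1 - Phi M by rewrite subr_gt0 Phi_lt1.
near=> n.
have n3 : (3 <= n)%N by near: n; exact: nbhs_infty_ge.
have n0 : 0 < n%:R :> R by rewrite ltr0n (leq_trans _ n3).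
have nM : (1 - Phi M)^-1 < n%:R by near: n; exact: nbhs_infty_gtr.
rewrite leNgt; apply/negP => bM.
have : Phi (b n) <= Phi M.
  rewrite /Phi fine_le ?fin_num_measure// le_measure ?inE//.
  by apply: subset_itvl; rewrite bnd_simp ltW.
have := hb n3; rewrite -[X in X < _]mul1r ltr_pdivrMr// in nM; nra.
Unshelve. all: by end_near. Qed.

Lemma near_norming_ge1 : \forall n \near \oo, 1 <= b n.
Proof. by move/cvgryPge : norming_cvgy; exact. Qed.

Lemma inv_norming_cvg0 : (b n)^-1 @[n --> \oo] --> (0 : R).
Proof.
apply/gtr0_cvgV0; last exact: norming_cvgy.
near=> n; apply: (@lt_le_trans _ _ 1) => //; near: n.
exact: near_norming_ge1.
Unshelve. all: by end_near. Qed.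

Lemma norming_h_cvg0 : h n @[n --> \oo] --> (0 : R).
Proof.
rewrite -[X in _ --> X](mulr0 (0 : R)).
by apply: cvgM; exact: inv_norming_cvg0.
Qed.

Lemma near_norming_h_neq0 : \forall n \near \oo, h n != 0.
Proof.
near=> n; rewrite /inv_sqr expf_neq0// invr_neq0// gt_eqF//.
by rewrite (@lt_le_trans _ _ 1)//; near: n; exact: near_norming_ge1.
Unshelve. all: by end_near. Qed.

(** From e^t >= t^3 / 3! at t = u^2 / 2; 48 is 2^3 3!. *)
Lemma expR_half_sqr_le u : 0 < u -> expR (- u ^+ 2 / (1 ^+ 2 *+ 2)) <= 48 * u^-1 ^+ 6.
Proof.
move=> u0; have u2 : 0 <= u ^+ 2 / 2 by rewrite divr_ge0// sqr_ge0.
rewrite expr1n mulNr expRN -[leRHS]invrK lef_pV2 ?posrE ?expR_gt0//; last first.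
  by rewrite invr_gt0 mulr_gt0// exprn_gt0// invr_gt0.
have := expR_ge1Dxn 2 u2; apply: le_trans.
rewrite invfM -exprVn invrK.
have -> : (u ^+ 2 / 2) ^+ 3 / 3`!%:R = 48^-1 * u ^+ 6.
  by rewrite !factS fact0; field.
by rewrite lerDr.
Qed.

(** For u >= 1, [mills u] is at least 1 / (2 u) and 1 + 15/u^6 at most 16; hence 32. *)
Lemma normal_tail_ge u : 1 <= u ->
  normal_peak 1 * expR (- u ^+ 2 / (1 ^+ 2 *+ 2)) / (32 * u) <= 1 - Phi u.
Proof.
move=> u1; have u0 : 0 < u by apply: lt_le_trans u1.
have pk : 0 < normal_peak (1 : R) by rewrite normal_peak_gt0// oner_neq0.
have /andP[_ ub] := normal_tail_mills_bounds u0.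
have k0 : 0 < u^-1 by rewrite invr_gt0.
have k1 : u^-1 <= 1 by rewrite invf_le1.
have k6 : u^-1 ^+ 6 <= 1 by rewrite exprn_ile1// ltW.
have m1 : u^-1 / 2 <= mills u.
  have : 0 <= u^-1 * (2^-1 - u^-1 ^+ 2 + 3 * (u^-1 ^+ 2) ^+ 2).
    by rewrite mulr_ge0 ?(ltW k0)//; nra.
  rewrite /mills; lra.
have t0 : 0 < 1 - Phi u by rewrite subr_gt0 Phi_lt1.
have E0 := expR_gt0 (- u ^+ 2 / (1 ^+ 2 *+ 2)).
have f0 : 0 <= phi u by exact: normal_pdf_ge0.
have : phi u * (u^-1 / 2) <= 16 * (1 - Phi u).
  apply: le_trans (_ : phi u * mills u <= _); first by rewrite ler_wpM2l.
  apply: le_trans ub _; rewrite ler_pM2r//; lra.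
rewrite {1}normal_pdf_expE ?oner_neq0// subr0.
set E := expR _ => H.
have -> : normal_peak 1 * E / (32 * u) = 16^-1 * (normal_peak 1 * E * (u^-1 / 2)).
  by field; rewrite gt_eqF.
by rewrite ler_pdivrMl.
Qed.

(** Here 1 / (n h^2) = (1 - Phi(b_n)) b_n^4. The tail is at most phi times [mills], with phi =
    O(b_n^-6) and [mills] at most 4, which leaves O(h). *)
Lemma inv_n_h2_cvg0 : (n%:R * h n ^+ 2)^-1 @[n --> \oo] --> (0 : R).
Proof.
pose K : R := normal_peak 1 * 48 * 4.
apply: (@squeeze_cvgr _ _ _ _ (fun=> 0) (fun n => K * h n)).
- near=> n.
  have n3 : (3 <= n)%N by near: n; exact: nbhs_infty_ge.
  have n0 : 0 < n%:R :> R by rewrite ltr0n (leq_trans _ n3).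
  have b1 : 1 <= b n by near: n; exact: near_norming_ge1.
  have b0 : 0 < b n by apply: lt_le_trans b1.
  have pk : 0 < normal_peak (1 : R) by rewrite normal_peak_gt0// oner_neq0.
  apply/andP; split.
    by rewrite invr_ge0 mulr_ge0 ?(ltW n0)// sqr_ge0.
  have -> : (n%:R * h n ^+ 2)^-1 = (1 - Phi (b n)) * (b n) ^+ 4.
    have -> : 1 - Phi (b n) = n%:R^-1.
      by apply: (mulfI (lt0r_neq0 n0)); rewrite hb// divff// gt_eqF.
    by rewrite /inv_sqr; field; rewrite !gt_eqF.
  have /andP[lb _] := normal_tail_mills_bounds b0.
  have k0 : 0 < (b n)^-1 by rewrite invr_gt0.
  have k1 : (b n)^-1 <= 1 by rewrite invf_le1.
  have m4 : mills (b n) <= 4.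
    rewrite /mills.
    have : 0 <= (b n)^-1 ^+ 3 by rewrite exprn_ge0// ltW.
    have : (b n)^-1 ^+ 5 <= 1 by rewrite exprn_ile1// ltW.
    lra.
  have m0 := mills_gt0 b0.
  have := expR_half_sqr_le b0; have := normal_pdf_expE (0 : R) (@oner_neq0 R).
  move=> pE eE.
  have f1 : phi (b n) <= normal_peak 1 * (48 * (b n)^-1 ^+ 6).
    by rewrite pE subr0 ler_pM2l.
  have f2 : phi (b n) * mills (b n) <= normal_peak 1 * (48 * (b n)^-1 ^+ 6) * 4.
    by apply: ler_pM => //; rewrite ?normal_pdf_ge0// ltW.
  apply: (@le_trans _ _ (normal_peak 1 * (48 * (b n)^-1 ^+ 6) * 4 * b n ^+ 4)).
    by rewrite ler_pM2r ?exprn_gt0// (le_trans lb).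
  rewrite le_eqVlt; apply/orP; left; apply/eqP; rewrite /K /inv_sqr; field.
  by rewrite gt_eqF.
- exact: cvg_cst.
- by rewrite -[X in _ --> X](mulr0 K); apply: cvgMl_tmp; exact: norming_h_cvg0.
Unshelve. all: by end_near. Qed.

Lemma expands2_negligible (e : nat -> R) :
  (e n * b n ^+ 4) @[n --> \oo] --> (0 : R) -> expands2 h e 0 0 0.
Proof.
move=> e0; exists (fun n => e n * b n ^+ 4) => //.
near=> n; have b1 : 1 <= b n by near: n; exact: near_norming_ge1.
rewrite /inv_sqr; field; rewrite gt_eqF//; exact: lt_le_trans b1.
Unshelve. all: by end_near. Qed.

(** The doubly rescaled difference is eventually the remainder [g] itself, so expansions translate
    directly into the limits sought. *)
Lemma cvg_expands2_coef f A B C : expands2 h f A B C ->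
  b n ^+ 2 * (b n ^+ 2 * (f n - A) - B) @[n --> \oo] --> C.
Proof.
move=> [g gC fE]; apply: cvg_trans gC; apply: near_eq_cvg.
near=> n; have b1 : 1 <= b n by near: n; exact: near_norming_ge1.
rewrite (near fE n)// /inv_sqr; field; rewrite gt_eqF//; exact: lt_le_trans b1.
Unshelve. all: by end_near. Qed.

(** As u_n(x) = b_n / w with w = 1 / (1 + h x) tending to 1, the error times b_n^4 is at most 15 h
    w^6. *)
Lemma expands2_mills_error x :
  expands2 h (fun n => 1 + mills_error (unorm (b n) x)) 1 0 0.
Proof.
pose w n := (1 + h n * x)^-1.
have w1 : w n @[n --> \oo] --> (1 : R).
  rewrite -[X in _ --> X]invr1; apply: cvgV; first exact: oner_neq0.
  rewrite -[X in _ --> X]addr0 -(mul0r x).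
  by apply: (cvgD (cvg_cst _)); apply: cvgM (cvg_cst _); exact: norming_h_cvg0.
suff e0 : expands2 h (fun n => mills_error (unorm (b n) x)) 0 0 0.
  apply: eq_expands2 (expands2D (expands2_cst h 1) e0); rewrite ?addr0//.
  exact: nearW.
apply: expands2_negligible.
apply: (@squeeze_cvgr _ _ _ _ (fun=> 0) (fun n => 15 * (h n * w n ^+ 6))).
- near=> n; have b1 : 1 <= b n by near: n; exact: near_norming_ge1.
  have b0 : 0 < b n by apply: lt_le_trans b1.
  have wn : 0 < w n.
    near: n; move: w1 => /cvgr_gt; apply; exact: ltr01.
  have u0 : 0 < unorm (b n) x.
    have -> : unorm (b n) x = b n / w n.
      by rewrite /unorm /w /inv_sqr invrK; field; rewrite gt_eqF.
    exact: divr_gt0.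
  have /andP[e0 e1] := mills_error_bounds u0.
  apply/andP; split; first by rewrite mulr_ge0// exprn_ge0// ltW.
  have -> : 15 * (h n * w n ^+ 6) = 15 * (unorm (b n) x)^-1 ^+ 6 * b n ^+ 4.
    have -> : unorm (b n) x = b n / w n.
      by rewrite /unorm /w /inv_sqr invrK; field; rewrite gt_eqF.
    by rewrite /inv_sqr; field; rewrite !gt_eqF.
  by rewrite ler_pM2r// exprn_gt0.
- exact: cvg_cst.
- rewrite -[X in _ --> X](mulr0 (15 : R)) -(mul0r (1 ^+ 6 : R)).
  apply: cvgMl_tmp; apply: cvgM; first exact: norming_h_cvg0.
  exact: (cvg_comp _ (fun t : R => t ^+ 6) w1 (@exprn_continuous R 6 _)).
Unshelve. all: by end_near. Qed.

(** With w = b_n / u, k = u^-2 and r the Mills error, p(u) / p(b_n) is the product of exp(- x - x^2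
    h / 2), w, (1 - k + 3 k^2) / (1 - h + 3 h^2) and (1 + r(b_n)) / (1 + r(u)); each factor is
    expanded and the results are multiplied. *)
Lemma expands2_normal_tail x :
  expands2 h (fun n => n%:R * (1 - Phi (unorm (b n) x)))
    (expR (- x)) (- s_fun x) (- t_fun x).
Proof.
have h0 := norming_h_cvg0; have eh := expands2_id h.
have cst c := expands2_cst h c.
have refl f : \forall n \near \oo, f n = f n :> R by exact: nearW.
pose w n := (1 + h n * x)^-1.
have ew : expands2 h w 1 (- x) (x ^+ 2).
  have e1 := expands2D (cst 1) (expands2M h0 eh (cst x)).
  have e2 : expands2 h (fun n => 1 + h n * x) 1 x 0.
    by apply: eq_expands2 e1 => //; ring.
  by apply: eq_expands2 (expands2V h0 _ e2) => //; rewrite ?oner_neq0//; field.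
pose k n := h n * (w n * w n).
have ek : expands2 h k 0 1 (- (2 * x)).
  by apply: eq_expands2 (expands2M h0 eh (expands2M h0 ew ew)) => //; ring.
(* Used with [k] for the numerator and with [h] for the denominator. *)
have em f c : expands2 h f 0 1 c ->
    expands2 h (fun n => 1 + (- 1 * f n + 3 * (f n * f n))) 1 (- 1) (3 - c).
  by move=> ef; apply: eq_expands2 (expands2D (cst 1) (expands2D
    (expands2M h0 (cst (- 1)) ef)
    (expands2M h0 (cst 3) (expands2M h0 ef ef)))) => //; ring.
have emb : expands2 h (fun n => (1 + (- 1 * h n + 3 * (h n * h n)))^-1) 1 1 (- 2).
  by apply: eq_expands2 (expands2V h0 _ (em _ _ eh)) => //; rewrite ?oner_neq0//; field.
have ee : expands2 h (fun n => expR (- x + - (x ^+ 2 / 2) * h n)) (expR (- x))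
    (expR (- x) * - (x ^+ 2 / 2)) (expR (- x) * (x ^+ 4 / 8)).
  have e1 := expands2D (cst (- x)) (expands2M h0 (cst (- (x ^+ 2 / 2))) eh).
  have e2 : expands2 h (fun n => - x + - (x ^+ 2 / 2) * h n)
      (- x) (- (x ^+ 2 / 2)) 0.
    by apply: eq_expands2 e1 => //; ring.
  by apply: eq_expands2 (expands2_expR h0 e2) => //; field.
have eru : expands2 h (fun n => (1 + mills_error (unorm (b n) x))^-1) 1 0 0.
  by apply: eq_expands2 (expands2V h0 _ (expands2_mills_error x)) => //;
    rewrite ?oner_neq0//; field.
(* b_n is u_n(0). *)
have erb : expands2 h (fun n => 1 + mills_error (b n)) 1 0 0.
  apply: eq_expands2 (expands2_mills_error 0) => //.
  by near=> n; rewrite /unorm mul0r addr0.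
have e := expands2M h0 ee (expands2M h0 ew (expands2M h0
  (expands2M h0 (em _ _ ek) emb) (expands2M h0 erb eru))).
apply: eq_expands2 e => //; rewrite /s_fun /t_fun; [|ring|field|field].
near=> n.
have n3 : (3 <= n)%N by near: n; exact: nbhs_infty_ge.
have n0 : 0 < n%:R :> R by rewrite ltr0n (leq_trans _ n3).
have b1 : 1 <= b n by near: n; exact: near_norming_ge1.
have b0 : 0 < b n by apply: lt_le_trans b1.
have wn : 0 < w n.
  near: n; move: (cvg_expands2 h0 ew) => /cvgr_gt; apply; exact: ltr01.
have uE : unorm (b n) x = b n / w n.
  by rewrite /unorm /w /inv_sqr invrK; field; rewrite gt_eqF.
have u0 : 0 < unorm (b n) x by rewrite uE divr_gt0.
have pb0 : 0 < 1 - Phi (b n) by rewrite subr_gt0 Phi_lt1.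
have -> : n%:R = (1 - Phi (b n))^-1.
  by apply: (mulIf (lt0r_neq0 pb0)); rewrite hb// mulVf// gt_eqF.
rewrite (normal_tail_mills b0) (normal_tail_mills u0).
have /andP[eb _] := mills_error_bounds b0; have /andP[eu _] := mills_error_bounds u0.
have {eb} : 0 < 1 + mills_error (b n) by rewrite ltr_pwDl.
have {eu} : 0 < 1 + mills_error (unorm (b n) x) by rewrite ltr_pwDl.
move: (1 + mills_error _) (1 + mills_error _) => eu eb eu0 eb0.
have phib0 : 0 < phi (b n).
  rewrite normal_pdf_expE ?oner_neq0//.
  by rewrite mulr_gt0 ?expR_gt0 ?normal_peak_gt0 ?oner_neq0.
(* Because u_n(x)^2 = b_n^2 + 2 x + x^2 h. *)
have -> : phi (unorm (b n) x) = phi (b n) * expR (- x + - (x ^+ 2 / 2) * h n).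
  rewrite normal_pdf_expE ?oner_neq0// -mulrA -expRD !subr0 expr1n.
  congr (_ * expR _); rewrite /unorm /inv_sqr; field; exact: lt0r_neq0.
have millsE v : mills v = v^-1 * (1 + (- 1 * v^-1 ^+ 2 + 3 * (v^-1 ^+ 2 * v^-1 ^+ 2))).
  by rewrite /mills; ring.
rewrite !millsE.
have -> : k n = (unorm (b n) x)^-1 ^+ 2.
  by rewrite uE /k /inv_sqr; field; rewrite !gt_eqF.
have -> : w n = b n * (unorm (b n) x)^-1 by rewrite uE; field; rewrite !gt_eqF.
rewrite -/(inv_sqr b n).
have q0 : 0 < 1 + (- 1 * h n + 3 * (h n * h n)) by nra.
move: (expR _) (1 + (- 1 * h n + _)) q0 => E q q0.
by field; rewrite !gt_eqF.
Unshelve. all: by end_near. Qed.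

End norming.

(** * The joint tail and the two limits *)

(** With E = exp(- b_n^2 / 2), the gap is at most e^-(x+y) E^2. One factor E is absorbed by n, as n
    E = O(b_n), and the other is O(b_n^-6); times b_n^4 this leaves O(1 / b_n). *)
Lemma gaussian_gap_negligible (R : realType) (b : nat -> R)
    (hb : forall n : nat, (3 <= n)%N -> n%:R * (1 - Phi (b n)) = 1)
    (rho : nat -> R) (F : R -> R -> R -> R)
    (hF : forall n : nat, (1 <= n)%N -> gaussian_cdf (rho n) (F (rho n)))
    (rho0 : forall n : nat, (1 <= n)%N -> rho n <= 0) (x y : R) :
  let u n := unorm (b n) x in let v n := unorm (b n) y in
  expands2 (inv_sqr b) (fun n =>
    n%:R * (F (rho n) (u n) (v n) - (Phi (u n) + Phi (v n) - 1))) 0 0 0.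
Proof.
move=> u v; apply: expands2_negligible => //.
have pk : 0 < normal_peak (1 : R) by rewrite normal_peak_gt0// oner_neq0.
pose K : R := 32 / normal_peak 1 * expR (- (x + y)) * 48.
apply: (@squeeze_cvgr _ _ _ _ (fun=> 0) (fun n => K * (b n)^-1)).
- have by0 : \forall n \near \oo, 1 - (x + y) <= b n.
    by move/cvgryPge : (norming_cvgy hb); exact.
  near=> n.
  have n3 : (3 <= n)%N by near: n; exact: nbhs_infty_ge.
  have n1 : (1 <= n)%N by rewrite (leq_trans _ n3).
  have n0 : 0 < n%:R :> R by rewrite ltr0n.
  have b1 : 1 <= b n by near: n; exact: near_norming_ge1.
  have b0 : 0 < b n by apply: lt_le_trans b1.
  have bi1 : (b n)^-1 <= 1 by rewrite invf_le1.
  have bi0 : 0 < (b n)^-1 by rewrite invr_gt0.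
  have bxy : 1 - (x + y) <= b n by near: n.
  have uvE : u n + v n = 2 * b n + (x + y) / b n by rewrite /u /v /unorm; ring.
  have uv1 : 1 <= u n + v n.
    (* For x + y < 0, (x + y) / b_n >= x + y, and [bxy] gives 2 b_n + x + y >= b_n + 1. *)
    by rewrite uvE; have [xy0|xy0] := leP 0 (x + y); nra.
  have /andP[g0 g1] := gaussian_cdf_gap (hF n n1) (rho0 n n1) uv1.
  set gap := (F _ _ _ - _) in g0 g1 *.
  have uv2 : (b n ^+ 2 + (x + y)) <= (u n + v n) ^+ 2 / 4.
    have -> : (u n + v n) ^+ 2 / 4 =
        b n ^+ 2 + (x + y) + ((x + y) / b n / 2) ^+ 2.
      by rewrite uvE; field; rewrite gt_eqF.
    by rewrite lerDl sqr_ge0.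
  pose E := expR (- b n ^+ 2 / (1 ^+ 2 *+ 2)).
  have E0 : 0 < E by exact: expR_gt0.
  have g2 : gap <= expR (- (x + y)) * (E * E).
    apply: le_trans g1 _; rewrite -!expRD ler_expR expr1n; lra.
  have tail := normal_tail_ge b1; rewrite -/E in tail.
  (* From n (1 - Phi(b_n)) = 1 and the lower tail bound. *)
  have nE : n%:R * E <= 32 * b n / normal_peak 1.
    rewrite ler_pdivlMr//.
    have : n%:R * (normal_peak 1 * E / (32 * b n)) <= 1.
      by rewrite -[leRHS](hb _ n3) ler_pM2l.
    have b32 : 0 < 32 * b n by rewrite mulr_gt0.
    by rewrite mulrA ler_pdivrMr// mul1r; apply: le_trans; lra.
  have E6 := expR_half_sqr_le b0; rewrite -/E in E6.
  apply/andP; split; first by rewrite mulr_ge0 ?exprn_ge0 ?(ltW b0)// mulr_ge0.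
  have e0 := expR_gt0 (- (x + y)).
  apply: (@le_trans _ _ (n%:R * (expR (- (x + y)) * (E * E)) * b n ^+ 4)).
    by rewrite ler_pM2r ?exprn_gt0// ler_pM2l.
  have -> : n%:R * (expR (- (x + y)) * (E * E)) * b n ^+ 4 =
      (n%:R * E) * E * (expR (- (x + y)) * b n ^+ 4) by ring.
  have -> : K / b n = (32 * b n / normal_peak 1) * (48 * (b n)^-1 ^+ 6) *
      (expR (- (x + y)) * b n ^+ 4).
    by rewrite /K; field; rewrite !gt_eqF.
  rewrite ler_pM2r ?mulr_gt0 ?exprn_gt0//.
  by apply: ler_pM => //; rewrite ?mulr_ge0 ?(ltW n0) ?(ltW E0).
- exact: cvg_cst.
- by rewrite -[X in _ --> X](mulr0 K); apply: cvgMl_tmp; exact: inv_norming_cvg0.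
Unshelve. all: by end_near. Qed.

Theorem theorem2p3 (R : realType)
    (F : R -> R -> R -> R)
    (hF : forall r : R, -1 <= r <= 1 -> gaussian_cdf r (F r))
    (b : nat -> R)
    (hb : forall n : nat, (3 <= n)%N -> n%:R * (1 - Phi (b n)) = 1)
    (rho : nat -> R) :
  ((forall n : nat, (1 <= n)%N -> -1 <= rho n <= 0) ->
   forall x y : R,
     (b n ^+ 2 *
        (b n ^+ 2 *
           (F (rho n) (unorm (b n) x) (unorm (b n) y) ^+ n - Hinfty x y)
         - (s_fun x + s_fun y) * Hinfty x y)) @[n --> \oo] -->
     (t_fun x + t_fun y + 2^-1 * (s_fun x + s_fun y) ^+ 2) * Hinfty x y)
  /\
  ((forall n : nat, (1 <= n)%N -> rho n = 1) ->
   forall x y : R,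
     (b n ^+ 2 *
        (b n ^+ 2 *
           (F 1 (unorm (b n) x) (unorm (b n) y) ^+ n - H0 x y)
         - s_fun (Num.min x y) * H0 x y)) @[n --> \oo] -->
     (t_fun (Num.min x y) + 2^-1 * s_fun (Num.min x y) ^+ 2) * H0 x y).
Proof.
have h0 := norming_h_cvg0 hb; have hn0 := near_norming_h_neq0 hb.
have nh0 := inv_n_h2_cvg0 hb.
split=> [hrho x y|_ x y]; apply: (cvg_expands2_coef hb).
- have hF' n : (1 <= n)%N -> gaussian_cdf (rho n) (F (rho n)).
    by move=> /hrho/andP[r1 r0]; apply: hF; rewrite r1 (le_trans r0).
  have rho0 n : (1 <= n)%N -> rho n <= 0 by move=> /hrho/andP[].
  have gap := gaussian_gap_negligible hb hF' rho0 x y.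
  have ex := expands2_normal_tail hb x; have ey := expands2_normal_tail hb y.
  have cN := expands2_cst (inv_sqr b) (-1).
  (* 1 - F is the sum of the two marginal tails minus the gap. *)
  have e : expands2 (inv_sqr b)
      (fun n => n%:R * (1 - F (rho n) (unorm (b n) x) (unorm (b n) y)))
      (expR (- x) + expR (- y)) (- (s_fun x + s_fun y)) (- (t_fun x + t_fun y)).
    have := expands2D (expands2D ex ey) (expands2M h0 cN gap).
    by apply: eq_expands2; [apply: nearW => n; ring|ring|ring|ring].
  have HE : Hinfty x y = expR (- (expR (- x) + expR (- y))).
    by rewrite /Hinfty /Lambda -expRD -opprD.
  apply: eq_expands2 (expands2_exprn_compl h0 hn0 nh0 e); rewrite ?HE.
  + by apply: nearW => n; rewrite subKr.
  + by [].
  + by rewrite opprK mulrC.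
  + by rewrite sqrrN opprK; ring.
- have F1 : gaussian_cdf 1 (F 1) by apply: hF; rewrite lexx andbT; lra.
  have e := expands2_exprn_compl h0 hn0 nh0 (expands2_normal_tail hb (Num.min x y)).
  apply: eq_expands2 e; rewrite /H0 ?opprK//.
  + near=> n.
    have b1 : 1 <= b n by near: n; exact: near_norming_ge1.
    have b0 : 0 < b n by apply: lt_le_trans b1.
    rewrite (gaussian_cdf1 _ _ F1) subKr; congr (Phi _ ^+ n).
    have bi0 : 0 < (b n)^-1 by rewrite invr_gt0.
    (* u_n is increasing because b_n > 0, so it commutes with the minimum. *)
    rewrite /unorm; case: (leP x y) => xy; first by rewrite min_l// lerD2l ler_pM2r.
    by rewrite min_r// lerD2l ler_pM2r// ltW.
  + by rewrite mulrC.
  + by rewrite sqrrN; ring.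
Unshelve. all: by end_near. Qed.
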